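(* Let $S=\mathbb{Z}\langle f,s,g\mid fg, fsg, fs^2g,\dots\rangle$ be the quotient of the free (non-commutative, unital) ring $\mathbb{Z}\langle f,s,g\rangle$ by the two-sided ideal generated by $\{fs^ig\mid i=0,1,2,\dots\}$. Let $\Sigma$ be the set of matrices with entries in $S[x]$ which become invertible under the augmentation $\epsilon:S[x]\to S$, $x\mapsto0$. Then the natural ring homomorphism $$\gamma:\Sigma^{-1}S[x]\to S[[x]]$$ is not injective.
   Context: Rings are associative with $1$. The indeterminate $x$ is central in $S[x]$ and in the formal power series ring $S[[x]]$. Cohn localization: if $A$ is a ring and $\Sigma$ is a set of matrices with entries in $A$, a ring homomorphism $A\to B$ is called $\Sigma$-inverting if every matrix in $\Sigma$ is mapped to an invertible matrix over $B$. The Cohn localization $i_\Sigma:A\to\Sigma^{-1}A$ is the universal $\Sigma$-inverting homomorphism: it is $\Sigma$-inverting and every $\Sigma$-inverting homomorphism $A\to B$ factors uniquely through $i_\Sigma$. When $A=S[x]$ and $\Sigma$ is the set of matrices with entries in $S[x]$ which become invertible under the augmentation $\epsilon:S[x]\to S$, $x\mapsto 0$, a matrix over $S[x]$ lies in $\Sigma$ if and only if it is invertible over $S[[x]]$, so the inclusion $S[x]\subset S[[x]]$ is $\Sigma$-inverting; $\gamma$ is the unique ring homomorphism such that $\gamma\circ i_\Sigma$ is this inclusion. *)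

(* Defs.v *)
From HB Require Import structures.
From mathcomp Require Import all_boot all_order all_algebra.
From mathcomp Require Import boolp monalg zify.

Set Implicit Arguments.
Unset Strict Implicit.
Unset Printing Implicit Defensive.

Import GRing.Theory.
Import Quotient.Exports.

Local Open Scope ring_scope.
Local Open Scope quotient_scope.

(** * Quotient of a ring by the two-sided ideal generated by a set.
    The library has ring quotients only in the commutative case. *)

Inductive in_ideal_span (R : pzRingType) (X : R -> Prop) : R -> Prop :=
| in_span_gen x : X x -> in_ideal_span X x
| in_span0 : in_ideal_span X 0
| in_spanB x y : in_ideal_span X x -> in_ideal_span X y -> in_ideal_span X (x - y)
| in_spanMl a x : in_ideal_span X x -> in_ideal_span X (a * x)
| in_spanMr a x : in_ideal_span X x -> in_ideal_span X (x * a).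

Definition ideal_span (R : pzRingType) (X : R -> Prop) : {pred R} :=
  fun x => `[< in_ideal_span X x >].

Section RingQuotient.
Variables (R : pzRingType) (X : R -> Prop).

Fact ideal_span_zmod_closed : zmod_closed (ideal_span X).
Proof.
split=> [|x y]; first by apply/asboolP/in_span0.
by move=> /asboolP Ix /asboolP Iy; apply/asboolP/in_spanB.
Qed.

HB.instance Definition _ :=
  GRing.isZmodClosed.Build R (ideal_span X) ideal_span_zmod_closed.

Definition ring_quot : Type := Quotient.quot (ideal_span X).

HB.instance Definition _ := GRing.Zmodule.on ring_quot.
HB.instance Definition _ : EqQuotient R (Quotient.equiv (ideal_span X)) ring_quot
  := EqQuotient.on ring_quot.

Lemma ring_quotP (x y : R) :
  reflect (\pi_ring_quot x = \pi_ring_quot y) (x - y \in ideal_span X).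
Proof. by rewrite (Quotient.idealrBE (ideal_span X)); apply: eqP. Qed.

Definition ring_quot_one : ring_quot := \pi_ring_quot (1 : R).
Definition ring_quot_mul (a b : ring_quot) : ring_quot :=
  \pi_ring_quot (repr a * repr b : R).

Lemma ring_quot_piM (x y : R) :
  \pi_ring_quot (x * y) = ring_quot_mul (\pi x) (\pi y).
Proof.
apply/ring_quotP/asboolP; set x' := repr _; set y' := repr _.
have /asboolP Ix : x - x' \in ideal_span X by apply/ring_quotP; rewrite reprK.
have /asboolP Iy : y' - y \in ideal_span X by apply/ring_quotP; rewrite reprK.
have -> : x * y - x' * y' = (x - x') * y - x' * (y' - y).
  by rewrite mulrBl mulrBr opprB addrA subrK.
by apply: in_spanB; [apply: in_spanMr | apply: in_spanMl].
Qed.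

Lemma ring_quot_piD (x y : R) :
  \pi_ring_quot (x + y) = \pi_ring_quot x + \pi_ring_quot y.
Proof. exact: (raddfD (\pi_(Quotient.quot (ideal_span X)))). Qed.

Fact ring_quot_mulA : associative ring_quot_mul.
Proof.
elim/quotW=> x; elim/quotW=> y; elim/quotW=> z.
by rewrite -!ring_quot_piM mulrA.
Qed.

Fact ring_quot_mul1r : left_id ring_quot_one ring_quot_mul.
Proof. by elim/quotW=> x; rewrite -ring_quot_piM mul1r. Qed.

Fact ring_quot_mulr1 : right_id ring_quot_one ring_quot_mul.
Proof. by elim/quotW=> x; rewrite -ring_quot_piM mulr1. Qed.

Fact ring_quot_mulDl : left_distributive ring_quot_mul +%R.
Proof.
elim/quotW=> x; elim/quotW=> y; elim/quotW=> z.
by rewrite -ring_quot_piD -!ring_quot_piM mulrDl ring_quot_piD.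
Qed.

Fact ring_quot_mulDr : right_distributive ring_quot_mul +%R.
Proof.
elim/quotW=> x; elim/quotW=> y; elim/quotW=> z.
by rewrite -ring_quot_piD -!ring_quot_piM mulrDr ring_quot_piD.
Qed.

HB.instance Definition _ := GRing.Zmodule_isPzRing.Build ring_quot
  ring_quot_mulA ring_quot_mul1r ring_quot_mulr1 ring_quot_mulDl ring_quot_mulDr.

Definition ring_proj : R -> ring_quot := \pi_ring_quot.

Fact ring_proj_is_zmod_morphism : zmod_morphism ring_proj.
Proof. exact: (raddfB (\pi_(Quotient.quot (ideal_span X)))). Qed.

Fact ring_proj_is_monoid_morphism : monoid_morphism ring_proj.
Proof. by split=> // x y; apply: ring_quot_piM. Qed.

HB.instance Definition _ :=
  GRing.isZmodMorphism.Build R ring_quot ring_proj ring_proj_is_zmod_morphism.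
HB.instance Definition _ :=
  GRing.isMonoidMorphism.Build R ring_quot ring_proj ring_proj_is_monoid_morphism.

Lemma ring_projP (x y : R) :
  ring_proj x = ring_proj y <-> in_ideal_span X (x - y).
Proof. by split=> [/ring_quotP/asboolP | /asboolP/ring_quotP]. Qed.

End RingQuotient.

(** * The ring [S = Z<f,s,g | fg, fsg, fs^2g, ...>].
    [free_fsg] is the monoid ring over [int] of the free monoid on three letters. *)

Notation free_fsg := {malg int[fmonom 'I_3]}.

Definition free_f : free_fsg := << fmu (@Ordinal 3 0 isT) >>.
Definition free_s : free_fsg := << fmu (@Ordinal 3 1 isT) >>.
Definition free_g : free_fsg := << fmu (@Ordinal 3 2 isT) >>.

Definition fsg_relator (r : free_fsg) : Prop :=
  exists i : nat, r = free_f * free_s ^+ i * free_g.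

Definition ring_fsg : Type := ring_quot fsg_relator.

HB.instance Definition _ := GRing.PzRing.on ring_fsg.

(* [{poly R}] requires [1 != 0] in [R]. *)
Fact ring_fsg_oner_neq0 : (1 : ring_fsg) != 0.
Proof.
apply/eqP=> E; have /ring_projP : ring_proj fsg_relator 1 = ring_proj fsg_relator 0.
  by rewrite rmorph1 rmorph0.
suff aug0 (r : free_fsg) : in_ideal_span fsg_relator r -> r@_mone = 0.
  by move=> /aug0; rewrite subr0 rmorph1.
elim=> [_ [i ->]||x y _ x0 _ y0|a x _ x0|a x _ x0].
- by rewrite !rmorphM /= mcoeffU1 -val_eqE /= fmU fm1 !mul0r.
- by rewrite rmorph0.
- by rewrite rmorphB /= x0 y0 subr0.
- by rewrite rmorphM /= x0 mulr0.
- by rewrite rmorphM /= x0 mul0r.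
Qed.

HB.instance Definition _ :=
  GRing.PzSemiRing_isNonZero.Build ring_fsg ring_fsg_oner_neq0.

(** * Formal power series [R[[x]]] in a central indeterminate *)

Record pseries (R : Type) := PSeries { pcoef : nat -> R }.

HB.instance Definition _ (R : Type) := [isNew for @pcoef R].
HB.instance Definition _ (R : choiceType) := [Choice of pseries R by <:].

Section PowerSeries.
Variable R : nzRingType.
Implicit Types a b c : pseries R.

Lemma pseriesP a b : pcoef a =1 pcoef b -> a = b.
Proof. by case: a b => [a] [b] /= /funext ->. Qed.

Definition pseries_zero : pseries R := PSeries (fun=> 0).
Definition pseries_one : pseries R := PSeries (fun i => (i == 0%N)%:R).
Definition pseries_opp a := PSeries (fun i => - pcoef a i).
Definition pseries_add a b := PSeries (fun i => pcoef a i + pcoef b i).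
Definition pseries_mul a b :=
  PSeries (fun i => \sum_(j < i.+1) pcoef a j * pcoef b (i - j)%N).

Fact pseries_addA : associative pseries_add.
Proof. by move=> a b c; apply: pseriesP => i /=; rewrite addrA. Qed.

Fact pseries_addC : commutative pseries_add.
Proof. by move=> a b; apply: pseriesP => i /=; rewrite addrC. Qed.

Fact pseries_add0 : left_id pseries_zero pseries_add.
Proof. by move=> a; apply: pseriesP => i /=; rewrite add0r. Qed.

Fact pseries_addN : left_inverse pseries_zero pseries_opp pseries_add.
Proof. by move=> a; apply: pseriesP => i /=; rewrite addNr. Qed.

HB.instance Definition _ := GRing.isZmodule.Build (pseries R)
  pseries_addA pseries_addC pseries_add0 pseries_addN.

Definition pseries_trunc n a : {poly R} := \poly_(i < n) pcoef a i.

Lemma coef_pseries_trunc n a i : (i < n)%N -> (pseries_trunc n a)`_i = pcoef a i.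
Proof. by move=> lt_in; rewrite coef_poly lt_in. Qed.

Lemma pcoef_mul_trunc n a b i : (i < n)%N ->
  pcoef (pseries_mul a b) i = (pseries_trunc n a * pseries_trunc n b)`_i.
Proof.
move=> lt_in; rewrite coefM; apply: eq_bigr => j _.
rewrite !coef_pseries_trunc //; first exact: leq_ltn_trans (leq_subr _ _) lt_in.
by apply: leq_ltn_trans lt_in; rewrite -ltnS.
Qed.

Fact pseries_mulA : associative pseries_mul.
Proof.
move=> a b c; apply: pseriesP => i.
have tr : forall j : 'I_i.+1, (i - j < i.+1)%N by move=> j; rewrite ltnS leq_subr.
transitivity ((pseries_trunc i.+1 a *
  (pseries_trunc i.+1 b * pseries_trunc i.+1 c))`_i).
  rewrite coefM /=; apply: eq_bigr => j _.
  by rewrite coef_pseries_trunc // -pcoef_mul_trunc.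
rewrite mulrA coefM /=; apply: eq_bigr => j _.
by rewrite coef_pseries_trunc // -pcoef_mul_trunc.
Qed.

Fact pseries_mul1r : left_id pseries_one pseries_mul.
Proof.
move=> a; apply: pseriesP => i /=; rewrite big_ord_recl /= mul1r subn0.
by rewrite big1 ?addr0 // => j _; rewrite mul0r.
Qed.

Fact pseries_mulr1 : right_id pseries_one pseries_mul.
Proof.
move=> a; apply: pseriesP => i /=; rewrite big_ord_recr /= subnn mulr1.
rewrite big1 ?add0r // => j _.
by rewrite subn_eq0 leqNgt ltn_ord mulr0.
Qed.

Fact pseries_mulDl : left_distributive pseries_mul pseries_add.
Proof.
move=> a b c; apply: pseriesP => i /=; rewrite -big_split /=.
by apply: eq_bigr => j _; rewrite mulrDl.
Qed.

Fact pseries_mulDr : right_distributive pseries_mul pseries_add.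
Proof.
move=> a b c; apply: pseriesP => i /=; rewrite -big_split /=.
by apply: eq_bigr => j _; rewrite mulrDr.
Qed.

Fact pseries_oner_neq0 : pseries_one != 0.
Proof. by apply/eqP=> /(congr1 (fun a => pcoef a 0)) /eqP; rewrite oner_eq0. Qed.

HB.instance Definition _ := GRing.Zmodule_isNzRing.Build (pseries R)
  pseries_mulA pseries_mul1r pseries_mulr1 pseries_mulDl pseries_mulDr
  pseries_oner_neq0.

Definition pseries_of_poly (p : {poly R}) : pseries R := PSeries (fun i => p`_i).

Fact pseries_of_poly_is_zmod_morphism : zmod_morphism pseries_of_poly.
Proof. by move=> p q; apply: pseriesP => i /=; rewrite coefB. Qed.

Fact pseries_of_poly_is_monoid_morphism : monoid_morphism pseries_of_poly.
Proof.
split=> [|p q]; apply: pseriesP => i /=; first by rewrite coef1.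
by rewrite coefM.
Qed.

HB.instance Definition _ := GRing.isZmodMorphism.Build {poly R} (pseries R)
  pseries_of_poly pseries_of_poly_is_zmod_morphism.
HB.instance Definition _ := GRing.isMonoidMorphism.Build {poly R} (pseries R)
  pseries_of_poly pseries_of_poly_is_monoid_morphism.

End PowerSeries.

(** * Cohn localization.
    Matrices may be rectangular, since over a general ring a non-square matrix
    can be invertible. *)

Definition mx_invertible (R : pzRingType) m n (M : 'M[R]_(m, n)) : Prop :=
  exists N : 'M[R]_(n, m), M *m N = 1%:M /\ N *m M = 1%:M.

Definition mx_set (A : pzRingType) := forall m n, 'M[A]_(m, n) -> Prop.

Definition inverting (A B : pzRingType) (Sigma : mx_set A) (h : A -> B) : Prop :=
  forall m n (M : 'M[A]_(m, n)), Sigma m n M -> mx_invertible (map_mx h M).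

Definition is_cohn_localization (A L : pzRingType) (Sigma : mx_set A)
    (i : {rmorphism A -> L}) : Prop :=
  inverting Sigma i /\
  forall (B : pzRingType) (h : {rmorphism A -> B}), inverting Sigma h ->
    exists g : {rmorphism L -> B}, (forall a, g (i a) = h a) /\
      forall g' : {rmorphism L -> B}, (forall a, g' (i a) = h a) -> g' =1 g.

Definition augmentation (R : nzRingType) (p : {poly R}) : R := p.[0].

Definition aug_invertible (R : nzRingType) : mx_set {poly R} :=
  fun m n M => mx_invertible (map_mx (@augmentation R) M).

(** ** A matrix over [R[x]] with invertible augmentation is invertible over [R[[x]]] *)

Section InvertingPseries.
Variable R : nzRingType.
Notation phi := (@pseries_of_poly R).

Lemma pcoef_sum I (r : seq I) (F : I -> pseries R) k :
  pcoef (\sum_(i <- r) F i) k = \sum_(i <- r) pcoef (F i) k.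
Proof. exact: (big_morph (fun a => pcoef a k)). Qed.

Section Neumann.
Variables (m : nat) (T : 'M[{poly R}]_m).
Hypothesis T0 : forall a b, (T a b)`_0 = 0.

Lemma coef_expmx_lt j k a b : (k < j)%N -> ((T ^+ j) a b)`_k = 0.
Proof.
elim: j k a b => // j IHj k a b lt_kj.
rewrite exprS mxE coef_sum big1 // => c _; rewrite coefM big1 // => -[[|i] lt_i] _.
  by rewrite T0 mul0r.
by rewrite IHj ?mulr0 //=; lia.
Qed.

Definition neumann_partial k : 'M[{poly R}]_m := \sum_(j < k.+1) T ^+ j.

Lemma coef_neumann_partial i k a b : (i <= k)%N ->
  (neumann_partial k a b)`_i = (neumann_partial i a b)`_i.
Proof.
elim: k => [|k IHk]; first by rewrite leqn0 => /eqP ->.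
rewrite leq_eqVlt => /predU1P[-> //|lt_ik].
by rewrite /neumann_partial big_ord_recr mxE coefD coef_expmx_lt ?addr0 ?IHk.
Qed.

Lemma neumann_partialMl k : (1 - T) * neumann_partial k = 1 - T ^+ k.+1.
Proof. by rewrite -[LHS]opprK -mulNr opprB -subrX1 opprB. Qed.

Lemma neumann_partialMr k : neumann_partial k * (1 - T) = 1 - T ^+ k.+1.
Proof.
rewrite -neumann_partialMl; apply/esym/commr_sum => j _.
by apply/commrX/commr_sym/commrB; [apply: commr1 | apply: commr_refl].
Qed.

Definition neumann_inverse : 'M[pseries R]_m :=
  \matrix_(a, b) PSeries (fun k => (neumann_partial k a b)`_k).

Lemma mx1_pcoef k a b :
  ((1 - T ^+ k.+1) a b)`_k = pcoef ((1%:M : 'M[pseries R]_m) a b) k.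
Proof.
rewrite !mxE coefB coef_expmx_lt // subr0.
by case: eqP => _; rewrite ?coef1 ?coef0.
Qed.

Lemma neumann_invertible : mx_invertible (map_mx phi (1 - T)).
Proof.
exists neumann_inverse; split; apply/matrixP=> a b; apply: pseriesP => k.
  rewrite -mx1_pcoef -neumann_partialMl !mxE pcoef_sum coef_sum.
  apply: eq_bigr => c _; rewrite coefM; apply: eq_bigr => i _; rewrite !mxE /=.
  by rewrite [X in _ = _ * X]coef_neumann_partial ?leq_subr.
rewrite -mx1_pcoef -neumann_partialMr !mxE pcoef_sum coef_sum.
apply: eq_bigr => c _; rewrite coefM; apply: eq_bigr => i _; rewrite !mxE /=.
by rewrite [X in _ = X * _]coef_neumann_partial // -ltnS.
Qed.

End Neumann.

Lemma aug0_invertible m (U : 'M[{poly R}]_m) :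
  map_mx (@augmentation R) U = 1%:M -> mx_invertible (map_mx phi U).
Proof.
move=> U1; rewrite -[U](subKr 1); apply: neumann_invertible => a b.
have /matrixP/(_ a b) := U1.
by rewrite !mxE /augmentation horner_coef0 coefB => ->; case: eqP;
  rewrite ?coef1 ?coef0 subrr.
Qed.

Lemma augmentation_mulC m n p (M : 'M[{poly R}]_(m, n)) (N : 'M[R]_(n, p)) :
  map_mx (@augmentation R) (M *m map_mx polyC N)
    = map_mx (@augmentation R) M *m N.
Proof.
apply/matrixP => a b; rewrite !mxE /augmentation horner_coef0 coef_sum.
by apply: eq_bigr => c _; rewrite !mxE coefMC horner_coef0.
Qed.

Lemma augmentation_Cmul m n p (N : 'M[R]_(m, n)) (M : 'M[{poly R}]_(n, p)) :
  map_mx (@augmentation R) (map_mx polyC N *m M)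
    = N *m map_mx (@augmentation R) M.
Proof.
apply/matrixP => a b; rewrite !mxE /augmentation horner_coef0 coef_sum.
by apply: eq_bigr => c _; rewrite !mxE coefCM horner_coef0.
Qed.

Theorem pseries_of_poly_inverting : inverting (@aug_invertible R) phi.
Proof.
move=> m n M [N [MN NM]].
have [U [MNU _]] : mx_invertible (map_mx phi (M *m map_mx polyC N)).
  by apply: aug0_invertible; rewrite augmentation_mulC.
have [V [_ VNM]] : mx_invertible (map_mx phi (map_mx polyC N *m M)).
  by apply: aug0_invertible; rewrite augmentation_Cmul.
rewrite map_mxM -mulmxA in MNU; rewrite map_mxM mulmxA in VNM.
exists (map_mx phi (map_mx polyC N) *m U); split => //.
suff -> : map_mx phi (map_mx polyC N) *m U = V *m map_mx phi (map_mx polyC N) by [].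
by rewrite -[LHS]mul1mx -VNM -!mulmxA MNU mulmx1.
Qed.

End InvertingPseries.

(** ** Existence of the Cohn localization, by generators and relations *)

Section CohnExistence.
Variables (A : pzRingType) (Sigma : mx_set A).

Inductive cterm : Type :=
| Cin of A
| Cinv m n (M : 'M[A]_(m, n)) of Sigma M & 'I_n & 'I_m
| Cadd of cterm & cterm
| Copp of cterm
| Cmul of cterm & cterm.

HB.instance Definition _ := gen_eqMixin cterm.
HB.instance Definition _ := gen_choiceMixin cterm.

Definition Csum (s : seq cterm) : cterm := foldr Cadd (Cin 0) s.

Inductive ceq : cterm -> cterm -> Prop :=
| ceq_refl t : ceq t t
| ceq_sym t u : ceq t u -> ceq u t
| ceq_trans t u v : ceq t u -> ceq u v -> ceq t v
| ceq_add t t' u u' : ceq t t' -> ceq u u' -> ceq (Cadd t u) (Cadd t' u')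
| ceq_opp t t' : ceq t t' -> ceq (Copp t) (Copp t')
| ceq_mul t t' u u' : ceq t t' -> ceq u u' -> ceq (Cmul t u) (Cmul t' u')
| ceq_addA t u v : ceq (Cadd t (Cadd u v)) (Cadd (Cadd t u) v)
| ceq_addC t u : ceq (Cadd t u) (Cadd u t)
| ceq_add0 t : ceq (Cadd (Cin 0) t) t
| ceq_addN t : ceq (Cadd (Copp t) t) (Cin 0)
| ceq_mulA t u v : ceq (Cmul t (Cmul u v)) (Cmul (Cmul t u) v)
| ceq_mul1r t : ceq (Cmul (Cin 1) t) t
| ceq_mulr1 t : ceq (Cmul t (Cin 1)) t
| ceq_mulDl t u v : ceq (Cmul (Cadd t u) v) (Cadd (Cmul t v) (Cmul u v))
| ceq_mulDr t u v : ceq (Cmul t (Cadd u v)) (Cadd (Cmul t u) (Cmul t v))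
| ceq_inD a b : ceq (Cin (a + b)) (Cadd (Cin a) (Cin b))
| ceq_inM a b : ceq (Cin (a * b)) (Cmul (Cin a) (Cin b))
| ceq_invr m n (M : 'M[A]_(m, n)) (SM : Sigma M) i k :
    ceq (Csum [seq Cmul (Cin (M i j)) (Cinv SM j k) | j <- enum 'I_n])
        (Cin ((1%:M : 'M[A]_m) i k))
| ceq_invl m n (M : 'M[A]_(m, n)) (SM : Sigma M) i k :
    ceq (Csum [seq Cmul (Cinv SM i j) (Cin (M j k)) | j <- enum 'I_m])
        (Cin ((1%:M : 'M[A]_n) i k)).

Definition ceqb : rel cterm := fun t u => `[< ceq t u >].

Fact ceqb_equiv : equiv_class_of ceqb.
Proof.
split=> [t|t u|u t v]; first by apply/asboolP/ceq_refl.
  by apply/asboolP/asboolP; apply: ceq_sym.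
by move=> /asboolP tu /asboolP uv; apply/asboolP/(ceq_trans tu uv).
Qed.

Canonical ceqb_equivRel := EquivRelPack ceqb_equiv.
Canonical ceqb_encModRel := defaultEncModRel ceqb.

Definition cohn : Type := {eq_quot ceqb}.
HB.instance Definition _ : EqQuotient cterm ceqb cohn := EqQuotient.on cohn.
HB.instance Definition _ := Choice.on cohn.

Definition cpi (t : cterm) : cohn := \pi_cohn t.

Lemma cpiP t u : cpi t = cpi u <-> ceq t u.
Proof.
by split=> [/eqP|tu]; [rewrite eqmodE => /asboolP | apply/eqmodP/asboolP].
Qed.

Lemma cpi_repr t : ceq (repr (cpi t)) t.
Proof. by apply/cpiP; rewrite /cpi reprK. Qed.

Lemma cpiW (P : cohn -> Prop) : (forall t, P (cpi t)) -> forall x, P x.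
Proof. by move=> Pt; elim/quotW. Qed.

Definition cohn_add (x y : cohn) : cohn := cpi (Cadd (repr x) (repr y)).
Definition cohn_opp (x : cohn) : cohn := cpi (Copp (repr x)).
Definition cohn_mul (x y : cohn) : cohn := cpi (Cmul (repr x) (repr y)).

Lemma cohn_addE t u : cohn_add (cpi t) (cpi u) = cpi (Cadd t u).
Proof. by apply/cpiP/ceq_add; apply: cpi_repr. Qed.

Lemma cohn_oppE t : cohn_opp (cpi t) = cpi (Copp t).
Proof. by apply/cpiP/ceq_opp; apply: cpi_repr. Qed.

Lemma cohn_mulE t u : cohn_mul (cpi t) (cpi u) = cpi (Cmul t u).
Proof. by apply/cpiP/ceq_mul; apply: cpi_repr. Qed.

Let cE := (cohn_addE, cohn_oppE, cohn_mulE).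

Fact cohn_addA : associative cohn_add.
Proof.
elim/cpiW=> t; elim/cpiW=> u; elim/cpiW=> v; rewrite !cE.
exact/cpiP/ceq_addA.
Qed.

Fact cohn_addC : commutative cohn_add.
Proof. by elim/cpiW=> t; elim/cpiW=> u; rewrite !cE; apply/cpiP/ceq_addC. Qed.

Fact cohn_add0 : left_id (cpi (Cin 0)) cohn_add.
Proof. by elim/cpiW=> t; rewrite !cE; apply/cpiP/ceq_add0. Qed.

Fact cohn_addN : left_inverse (cpi (Cin 0)) cohn_opp cohn_add.
Proof. by elim/cpiW=> t; rewrite !cE; apply/cpiP/ceq_addN. Qed.

HB.instance Definition _ := GRing.isZmodule.Build cohn
  cohn_addA cohn_addC cohn_add0 cohn_addN.

Fact cohn_mulA : associative cohn_mul.
Proof.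
elim/cpiW=> t; elim/cpiW=> u; elim/cpiW=> v; rewrite !cE.
exact/cpiP/ceq_mulA.
Qed.

Fact cohn_mul1r : left_id (cpi (Cin 1)) cohn_mul.
Proof. by elim/cpiW=> t; rewrite !cE; apply/cpiP/ceq_mul1r. Qed.

Fact cohn_mulr1 : right_id (cpi (Cin 1)) cohn_mul.
Proof. by elim/cpiW=> t; rewrite !cE; apply/cpiP/ceq_mulr1. Qed.

Fact cohn_mulDl : left_distributive cohn_mul cohn_add.
Proof.
elim/cpiW=> t; elim/cpiW=> u; elim/cpiW=> v; rewrite !cE.
exact/cpiP/ceq_mulDl.
Qed.

Fact cohn_mulDr : right_distributive cohn_mul cohn_add.
Proof.
elim/cpiW=> t; elim/cpiW=> u; elim/cpiW=> v; rewrite !cE.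
exact/cpiP/ceq_mulDr.
Qed.

HB.instance Definition _ := GRing.Zmodule_isPzRing.Build cohn
  cohn_mulA cohn_mul1r cohn_mulr1 cohn_mulDl cohn_mulDr.

Definition cohn_in (a : A) : cohn := cpi (Cin a).

Lemma cpiD t u : cpi (Cadd t u) = cpi t + cpi u.
Proof. exact/esym/cohn_addE. Qed.

Lemma cpiN t : cpi (Copp t) = - cpi t.
Proof. exact/esym/cohn_oppE. Qed.

Lemma cpiM t u : cpi (Cmul t u) = cpi t * cpi u.
Proof. exact/esym/cohn_mulE. Qed.

Fact cohn_in_is_zmod_morphism : zmod_morphism cohn_in.
Proof.
move=> a b; apply/esym/(canLR (addrK _)); rewrite /cohn_in -cpiD.
by apply/cpiP; rewrite -[a in Cin a](subrK b); apply: ceq_inD.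
Qed.

Fact cohn_in_is_monoid_morphism : monoid_morphism cohn_in.
Proof. by split=> // a b; rewrite /cohn_in -cpiM; apply/cpiP/ceq_inM. Qed.

HB.instance Definition _ :=
  GRing.isZmodMorphism.Build A cohn cohn_in cohn_in_is_zmod_morphism.
HB.instance Definition _ :=
  GRing.isMonoidMorphism.Build A cohn cohn_in cohn_in_is_monoid_morphism.

Lemma cpi_sum (I : finType) (F : I -> cterm) :
  cpi (Csum [seq F j | j <- enum I]) = \sum_j cpi (F j).
Proof.
by rewrite -big_enum /=; elim: (enum I) => [|j s IHs] /=;
  rewrite ?big_nil // big_cons cpiD IHs.
Qed.

Lemma cohn_in_inverting : inverting Sigma cohn_in.
Proof.
move=> m n M SM; exists (\matrix_(j, k) cpi (Cinv SM j k)).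
split; apply/matrixP=> i k.
  transitivity (cohn_in ((1%:M : 'M_m) i k)).
    rewrite /cohn_in -((cpiP _ _).2 (ceq_invr SM i k)) cpi_sum mxE.
    by apply: eq_bigr => j _; rewrite !mxE cpiM.
  by rewrite !mxE rmorph_nat.
transitivity (cohn_in ((1%:M : 'M_n) i k)).
  rewrite /cohn_in -((cpiP _ _).2 (ceq_invl SM i k)) cpi_sum mxE.
  by apply: eq_bigr => j _; rewrite !mxE cpiM.
by rewrite !mxE rmorph_nat.
Qed.

Section Universal.
Variables (B : pzRingType) (h : {rmorphism A -> B}).
Hypothesis hinv : inverting Sigma h.

Fixpoint ceval (t : cterm) : B :=
  match t with
  | Cin a => h a
  | Cinv _ _ M SM j k => sval (cid (hinv SM)) j k
  | Cadd t u => ceval t + ceval u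
  | Copp t => - ceval t
  | Cmul t u => ceval t * ceval u
  end.

Lemma ceval_sum (I : finType) (F : I -> cterm) :
  ceval (Csum [seq F j | j <- enum I]) = \sum_j ceval (F j).
Proof.
by rewrite -big_enum /=; elim: (enum I) => [|j s IHs] /=;
  rewrite ?big_nil ?rmorph0 // big_cons IHs.
Qed.

Lemma ceval_ceq t u : ceq t u -> ceval t = ceval u.
Proof.
elim=> {t u} //=.
- by move=> t u v _ -> _ ->.
- by move=> t t' u u' _ -> _ ->.
- by move=> t t' _ ->.
- by move=> t t' u u' _ -> _ ->.
- by move=> t u v; rewrite addrA.
- by move=> t u; rewrite addrC.
- by move=> t; rewrite rmorph0 add0r.
- by move=> t; rewrite rmorph0 addNr.
- by move=> t u v; rewrite mulrA.
- by move=> t; rewrite rmorph1 mul1r.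
- by move=> t; rewrite rmorph1 mulr1.
- by move=> t u v; rewrite mulrDl.
- by move=> t u v; rewrite mulrDr.
- by move=> a b; rewrite rmorphD.
- by move=> a b; rewrite rmorphM.
- move=> m n M SM i k; rewrite ceval_sum /=; case: cid => N /= [/matrixP MN _].
  have := MN i k; rewrite !mxE rmorph_nat => <-.
  by apply: eq_bigr => j _; rewrite !mxE.
- move=> m n M SM i k; rewrite ceval_sum /=; case: cid => N /= [_ /matrixP NM].
  have := NM i k; rewrite !mxE rmorph_nat => <-.
  by apply: eq_bigr => j _; rewrite !mxE.
Qed.

Definition cohn_lift (x : cohn) : B := ceval (repr x).

Lemma cohn_liftE t : cohn_lift (cpi t) = ceval t.
Proof. exact/ceval_ceq/cpi_repr. Qed.

Fact cohn_lift_is_zmod_morphism : zmod_morphism cohn_lift.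
Proof.
by elim/cpiW=> t; elim/cpiW=> u; rewrite -cpiN -cpiD !cohn_liftE.
Qed.

Fact cohn_lift_is_monoid_morphism : monoid_morphism cohn_lift.
Proof.
split; first by rewrite cohn_liftE /= rmorph1.
by elim/cpiW=> t; elim/cpiW=> u; rewrite -cpiM !cohn_liftE.
Qed.

HB.instance Definition _ :=
  GRing.isZmodMorphism.Build cohn B cohn_lift cohn_lift_is_zmod_morphism.
HB.instance Definition _ :=
  GRing.isMonoidMorphism.Build cohn B cohn_lift cohn_lift_is_monoid_morphism.

Lemma cohn_lift_unique (g : {rmorphism cohn -> B}) :
  (forall a, g (cohn_in a) = h a) -> g =1 cohn_lift.
Proof.
move=> gh; elim/cpiW=> t; rewrite cohn_liftE.
elim: t => [a|m n M SM j k|t IHt u IHu|t IHt|t IHt u IHu] /=; first exact: gh.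
- case: cid => N /= [MN _]; pose N' := \matrix_(j, k) g (cpi (Cinv SM j k)).
  suff -> : N = N' by rewrite mxE.
  suff N'M : N' *m map_mx h M = 1%:M.
    by rewrite -[LHS]mul1mx -N'M -mulmxA MN mulmx1.
  apply/matrixP=> i l; transitivity (g (cohn_in ((1%:M : 'M_n) i l))).
    rewrite /cohn_in -((cpiP _ _).2 (ceq_invl SM i l)) cpi_sum rmorph_sum mxE.
    by apply: eq_bigr => p _; rewrite !mxE cpiM rmorphM -gh.
  by rewrite gh !mxE rmorph_nat.
- by rewrite cpiD rmorphD IHt IHu.
- by rewrite cpiN rmorphN IHt.
- by rewrite cpiM rmorphM IHt IHu.
Qed.

End Universal.

Theorem cohn_localization_exists :
  exists (L : pzRingType) (i : {rmorphism A -> L}), is_cohn_localization Sigma i.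
Proof.
exists cohn, cohn_in; split=> [|B h hinv]; first exact: cohn_in_inverting.
exists (cohn_lift hinv); split=> [a|g]; first exact: (cohn_liftE hinv).
exact: (cohn_lift_unique hinv).
Qed.

End CohnExistence.

(* Main.v *)
Require Import Defs.
From HB Require Import structures.
From mathcomp Require Import all_boot all_order all_algebra.
From mathcomp Require Import boolp monalg.

(** The element [z = f (1 - s x)^-1 g] of the localization lies in the kernel of
    gamma: in [S[[x]]] the inverse of [1 - s x] is the geometric series, so the
    coefficients of the image of [z] are the relators [f s^k g], all zero
    ([geometric_corner_eq0]).

    That [z] itself is nonzero is a finiteness phenomenon.  A relation in the
    localization involves finitely many elements of [S], hence finitely many of
    the relators, whereas the vanishing of [z] in power series requires all of
    them.  To turn this into a proof, take rings [T_n] with a morphism from the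
    free ring [Z<f,s,g>] that kills [f s^k g] for all [k <> n] but not for
    [k = n]: matrices of size [n + 1] in which [s] is a nilpotent shift and
    [f], [g] are diagonal matrix units at the two ends ([fsg_eval_relator]).

    Each relator dies in [T_n] for all large [n], so [S[x]] maps to the reduced
    product [B] of the rings [T_n[[x]]], that is, sequences modulo eventual
    equality.  If the augmentation of a matrix over [S[x]] is invertible,
    then, an invertibility equation being finitely many equations in [S], it
    holds after lifting to the free ring and evaluating in [T_n] for all large
    [n]; there the matrix is invertible over [T_n[[x]]], and choosing an
    inverse for each such [n] gives one over [B] ([fsg_germ_inverting]).  By
    universality the localization maps to [B].  The image of [z] is the germ
    of [f_n (1 - s_n x)^-1 g_n], whose [n]-th component has
    [f_n s_n^n g_n <> 0] as coefficient of [x^n]; it is nonzero for every [n],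
    so the germ is nonzero ([fsg_germ_corner_neq0]).

    The product must be taken of the power series rings: with power series over
    the reduced product of the [T_n], the coefficients of the image of [z]
    would again be germs of eventually zero sequences. *)

Set Implicit Arguments.
Unset Strict Implicit.
Unset Printing Implicit Defensive.

Import GRing.Theory.

Local Open Scope ring_scope.

(** * Properties holding for all large indices *)

Definition eventually (P : nat -> Prop) : Prop :=
  exists N, forall n, (N <= n)%N -> P n.

Lemma eventually_all (P : nat -> Prop) : (forall n, P n) -> eventually P.
Proof. by exists 0%N. Qed.

Lemma eventually_impl2 (P Q C : nat -> Prop) :
  (forall n, P n -> Q n -> C n) -> eventually P -> eventually Q -> eventually C.
Proof.
move=> PQC [N PN] [N' QN]; exists (maxn N N') => n.
by rewrite geq_max => /andP[/PN Pn /QN]; apply: PQC.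
Qed.

Lemma eventually_impl (P C : nat -> Prop) :
  (forall n, P n -> C n) -> eventually P -> eventually C.
Proof. by move=> PC evP; apply: (eventually_impl2 _ evP evP) => n /PC. Qed.

(** Only finitely many conditions can be met simultaneously; this is the source
    of all the finiteness used below. *)
Lemma eventually_forall (I : finType) (P : I -> nat -> Prop) :
  (forall i, eventually (P i)) -> eventually (fun n => forall i, P i n).
Proof.
move=> /choice[N PN]; exists (\max_i N i) => n le_n i.
by apply/PN/(leq_trans _ le_n)/leq_bigmax.
Qed.

Lemma eventually_eq_mx (T : nat -> Type) m k (M N : forall n, 'M[T n]_(m, k)) :
  (forall a b, eventually (fun n => M n a b = N n a b)) ->
  eventually (fun n => M n = N n).
Proof.
move=> MN; apply: eventually_impl (_ : eventually (fun n =>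
    forall ab : 'I_m * 'I_k, M n ab.1 ab.2 = N n ab.1 ab.2)).
  by move=> n MNn; apply/matrixP => a b; apply: (MNn (a, b)).
by apply: eventually_forall => -[a b]; apply: MN.
Qed.

(** * Reduced products of rings *)

Section ReducedProduct.
Variable T : nat -> pzRingType.

Definition seq_prod : Type := forall n, T n.

HB.instance Definition _ := gen_eqMixin seq_prod.
HB.instance Definition _ := gen_choiceMixin seq_prod.

Implicit Types u v w : seq_prod.

Lemma seq_prodP u v : (forall n, u n = v n) -> u = v.
Proof. exact: functional_extensionality_dep. Qed.

Definition seq_zero : seq_prod := fun=> 0.
Definition seq_one : seq_prod := fun=> 1.
Definition seq_opp u : seq_prod := fun n => - u n.
Definition seq_add u v : seq_prod := fun n => u n + v n.
Definition seq_mul u v : seq_prod := fun n => u n * v n.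

Fact seq_addA : associative seq_add.
Proof. by move=> u v w; apply: seq_prodP => n; apply: addrA. Qed.

Fact seq_addC : commutative seq_add.
Proof. by move=> u v; apply: seq_prodP => n; apply: addrC. Qed.

Fact seq_add0 : left_id seq_zero seq_add.
Proof. by move=> u; apply: seq_prodP => n; apply: add0r. Qed.

Fact seq_addN : left_inverse seq_zero seq_opp seq_add.
Proof. by move=> u; apply: seq_prodP => n; apply: addNr. Qed.

HB.instance Definition _ := GRing.isZmodule.Build seq_prod
  seq_addA seq_addC seq_add0 seq_addN.

Fact seq_mulA : associative seq_mul.
Proof. by move=> u v w; apply: seq_prodP => n; apply: mulrA. Qed.

Fact seq_mul1r : left_id seq_one seq_mul.
Proof. by move=> u; apply: seq_prodP => n; apply: mul1r. Qed.

Fact seq_mulr1 : right_id seq_one seq_mul.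
Proof. by move=> u; apply: seq_prodP => n; apply: mulr1. Qed.

Fact seq_mulDl : left_distributive seq_mul +%R.
Proof. by move=> u v w; apply: seq_prodP => n; apply: mulrDl. Qed.

Fact seq_mulDr : right_distributive seq_mul +%R.
Proof. by move=> u v w; apply: seq_prodP => n; apply: mulrDr. Qed.

HB.instance Definition _ := GRing.Zmodule_isPzRing.Build seq_prod
  seq_mulA seq_mul1r seq_mulr1 seq_mulDl seq_mulDr.

Definition seq_comp n u : T n := u n.

Fact seq_comp_is_zmod_morphism n : zmod_morphism (seq_comp n).
Proof. by []. Qed.
Fact seq_comp_is_monoid_morphism n : monoid_morphism (seq_comp n).
Proof. by []. Qed.
HB.instance Definition _ n := GRing.isZmodMorphism.Build seq_prod (T n)
  (seq_comp n) (seq_comp_is_zmod_morphism n).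
HB.instance Definition _ n := GRing.isMonoidMorphism.Build seq_prod (T n)
  (seq_comp n) (seq_comp_is_monoid_morphism n).

Section Pairing.
Variables (P : pzRingType) (h : forall n, {rmorphism P -> T n}).

Definition seq_map (p : P) : seq_prod := fun n => h n p.

Fact seq_map_is_zmod_morphism : zmod_morphism seq_map.
Proof. by move=> p q; apply: seq_prodP => n; apply: rmorphB. Qed.
Fact seq_map_is_monoid_morphism : monoid_morphism seq_map.
Proof.
by split=> [|p q]; apply: seq_prodP => n; [apply: rmorph1 | apply: rmorphM].
Qed.
HB.instance Definition _ := GRing.isZmodMorphism.Build P seq_prod
  seq_map seq_map_is_zmod_morphism.
HB.instance Definition _ := GRing.isMonoidMorphism.Build P seq_prod
  seq_map seq_map_is_monoid_morphism.

End Pairing.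

Definition eventually_zero u : Prop := eventually (fun n => u n = 0).

(** The eventually zero sequences already form an ideal, so that passing to the
    ideal they generate adds nothing. *)
Lemma in_span_eventually_zero u :
  in_ideal_span eventually_zero u -> eventually_zero u.
Proof.
elim=> // [|v w _ ev_v _|v w _|v w _].
- exact: eventually_all.
- apply: eventually_impl2 ev_v => n v0 w0.
  by rewrite -[LHS]/(v n - w n) v0 w0 subr0.
- by apply: eventually_impl => n w0; rewrite -[LHS]/(v n * w n) w0 mulr0.
- by apply: eventually_impl => n w0; rewrite -[LHS]/(w n * v n) w0 mul0r.
Qed.

Definition germ : seq_prod -> ring_quot eventually_zero :=
  ring_proj eventually_zero.

HB.instance Definition _ := GRing.RMorphism.on germ.

Lemma germP u v : germ u = germ v <-> eventually (fun n => u n = v n).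
Proof.
rewrite /germ ring_projP; split=> [/in_span_eventually_zero|ev].
  by apply: eventually_impl => n /subr0_eq.
apply: in_span_gen; apply: eventually_impl ev => n uv.
by rewrite -[LHS]/(u n - v n) uv subrr.
Qed.

Lemma germ_surj b : exists u, germ u = b.
Proof. by exists (repr b); rewrite /germ /ring_proj reprK. Qed.

Lemma germ_mxP m k (M N : 'M[seq_prod]_(m, k)) :
  map_mx germ M = map_mx germ N <->
  eventually (fun n => map_mx (seq_comp n) M = map_mx (seq_comp n) N).
Proof.
split=> [/matrixP MN | ev].
  apply: eventually_eq_mx => i j; have := MN i j; rewrite !mxE => /germP.
  by apply: eventually_impl => n; rewrite !mxE.
apply/matrixP=> i j; rewrite !mxE; apply/germP; apply: eventually_impl ev.
by move=> n /matrixP/(_ i j); rewrite !mxE.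
Qed.

(** Inverses of the components assemble into an inverse of the germ: the
    finitely many components that are not invertible are invisible there. *)
Lemma germ_mx_invertible m k (M : 'M[seq_prod]_(m, k)) :
  eventually (fun n => mx_invertible (map_mx (seq_comp n) M)) ->
  mx_invertible (map_mx germ M).
Proof.
move=> [N0 invM].
(* Below N0 there may be no inverse; any matrix will do, for instance 0. *)
have invP n : {P : 'M[T n]_(k, m) | (N0 <= n)%N ->
    map_mx (seq_comp n) M *m P = 1%:M /\ P *m map_mx (seq_comp n) M = 1%:M}.
  apply: cid; case: leqP => [/invM[P PE]|]; first by exists P.
  by exists 0.
pose P : 'M[seq_prod]_(k, m) := \matrix_(i, j) (fun n => sval (invP n) i j).
have PE n : map_mx (seq_comp n) P = sval (invP n).
  by apply/matrixP=> i j; rewrite !mxE.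
exists (map_mx germ P); rewrite -!map_mxM -!(map_mx1 germ).
by split; apply/germ_mxP; exists N0 => n /(svalP (invP n))[MP PM];
  rewrite map_mxM map_mx1 /= PE.
Qed.

End ReducedProduct.

(** * Morphisms out of a quotient and out of a free ring *)

Lemma rmorphism_factor (P Q B : pzRingType) (pi : {rmorphism P -> Q})
    (h : {rmorphism P -> B}) :
    (forall q, exists p, pi p = q) -> (forall p, pi p = 0 -> h p = 0) ->
  exists hbar : {rmorphism Q -> B}, forall p, hbar (pi p) = h p.
Proof.
move=> /choice[lift liftK] ker_pi; pose hbar := h \o lift.
have hbarE p : hbar (pi p) = h p.
  apply/subr0_eq; rewrite -rmorphB; apply: ker_pi.
  by rewrite rmorphB liftK subrr.
have hbarB : zmod_morphism hbar.
  by move=> q r; rewrite -[q]liftK -[r]liftK -rmorphB !hbarE rmorphB.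
have hbarM : monoid_morphism hbar.
  split=> [|q r]; first by rewrite -(rmorph1 pi) hbarE rmorph1.
  by rewrite -[q]liftK -[r]liftK -rmorphM !hbarE rmorphM.
pose bB := GRing.isZmodMorphism.Build Q B hbar hbarB.
pose bM := GRing.isMonoidMorphism.Build Q B hbar hbarM.
pose hbarR : {rmorphism Q -> B} := HB.pack hbar bB bM.
by exists hbarR.
Qed.

Section FreeAlgebraEvaluation.
Variables (I : choiceType) (T : nzRingType) (v : I -> T).

Definition fmonom_eval (m : {fmonom I}) : T := \prod_(i <- m) v i.

Fact fmonom_eval_is_mmorphism : mmorphism fmonom_eval.
Proof.
split=> [m1 m2|]; rewrite /fmonom_eval; last by rewrite fm1 big_nil.
by rewrite fmM big_cat.
Qed.
HB.instance Definition _ := isMultiplicative.Build {fmonom I} T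
  fmonom_eval fmonom_eval_is_mmorphism.

Definition free_eval : {malg int[{fmonom I}]} -> T := mmap intr fmonom_eval.

HB.instance Definition _ := GRing.Additive.on free_eval.

Fact free_eval_is_monoid_morphism : monoid_morphism free_eval.
Proof.
(* The coefficients are integers, whose images are central even if T is not
   commutative. *)
have [evalM eval1] : multiplicative free_eval.
  by apply: commr_mmap_is_multiplicative => p m m'; apply/commr_sym/commr_int.
by [].
Qed.
HB.instance Definition _ := GRing.isMonoidMorphism.Build _ _
  free_eval free_eval_is_monoid_morphism.

Lemma free_evalU i : free_eval << fmu i >> = v i.
Proof.
by rewrite /free_eval mmapU /= mulr1z mul1r /fmonom_eval fmU big_seq1.
Qed.

End FreeAlgebraEvaluation.

(** * A shift matrix seen from two corners *)

Lemma delta_mx_sandwich (R : pzRingType) m (i j k l : 'I_m) (M : 'M[R]_m) :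
  delta_mx i j *m M *m delta_mx k l = M j k *: delta_mx i l.
Proof.
apply/matrixP=> a b; rewrite !mxE (bigD1 k) //= big1 => [|c /negPf ck].
  rewrite !mxE (bigD1 j) //= big1 => [|c /negPf cj].
    rewrite !mxE !eqxx andbT !addr0 /=.
    by case: (a == i); case: (b == l); rewrite ?(mul1r, mulr1, mul0r, mulr0).
  by rewrite !mxE cj andbF mul0r.
by rewrite [delta_mx k l c b]mxE ck mulr0.
Qed.

Section ShiftMatrix.
Variable n : nat.

Definition shift_mx : 'M[int]_n.+1 := \matrix_(i, j) (i == j.+1 :> nat)%:R.

Lemma shift_mx_pow k (a b : 'I_n.+1) :
  (shift_mx ^+ k) a b = (a == k + b :> nat)%N%:R.
Proof.
elim: k a b => [|k IHk] a b; first by rewrite expr0 mxE.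
rewrite exprS mxE; under eq_bigr do rewrite mxE IHk -natrM mulnb.
have [aE|aNE] := eqVneq (a : nat) (k.+1 + b)%N.
  have lt_kb : (k + b < n.+1)%N by rewrite ltnW // -[leqLHS]/(k.+1 + b).+1 -aE.
  rewrite (bigD1 (Ordinal lt_kb)) //= aE !eqxx big1 ?addr0 // => c.
  by rewrite -val_eqE /= => /negPf ->; rewrite andbF.
rewrite big1 // => c _; case: eqP => // aE; case: eqP => // cE.
by rewrite aE cE eqxx in aNE.
Qed.

(** The power [k] of the shift moves basis vector 0 to basis vector [k], and the
    last one is reached exactly for [k = n]. *)
Lemma corner_shift_pow k :
  delta_mx ord_max ord_max * shift_mx ^+ k * delta_mx 0 0
    = (n == k)%:R *: delta_mx ord_max 0.
Proof. by rewrite [LHS]delta_mx_sandwich shift_mx_pow /= addn0. Qed.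

End ShiftMatrix.

(** * The geometric series *)

Section GeometricSeries.
Variable R : nzRingType.
Implicit Types (r s t : R) (y : pseries R).

Lemma pcoef_polyC_mul r y k :
  pcoef (pseries_of_poly r%:P * y) k = r * pcoef y k.
Proof.
rewrite /= big_ord_recl /= coefC subn0 big1 ?addr0 // => j _.
by rewrite /= coefC mul0r.
Qed.

Lemma pcoef_mul_polyC y r k :
  pcoef (y * pseries_of_poly r%:P) k = pcoef y k * r.
Proof.
rewrite /= big_ord_recr /= coefC subnn big1 ?add0r // => j _.
by rewrite /= coefC subn_eq0 leqNgt ltn_ord mulr0.
Qed.

Lemma pcoef_polyX_mul y k :
  pcoef (pseries_of_poly 'X * y) k = if k is k'.+1 then pcoef y k' else 0.
Proof.
rewrite /= big_ord_recl coefX mul0r add0r.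
case: k => [|k]; first by rewrite big_ord0.
rewrite big_ord_recl coefX mul1r /= subSS subn0 big1 ?addr0 // => j _.
by rewrite coefX mul0r.
Qed.

(** The equation reads [y = 1 + s x y], which determines the coefficients of [y]
    one after the other. *)
Lemma pcoef_geometric s y k :
  pseries_of_poly (1 - s%:P * 'X) * y = 1 -> pcoef y k = s ^+ k.
Proof.
rewrite rmorphB rmorph1 mulrBl mul1r rmorphM /= -mulrA => /(canRL (subrK _)) yE.
elim: k => [|k IHk].
  by rewrite yE -[LHS]/(_ + _) pcoef_polyC_mul pcoef_polyX_mul mulr0 addr0.
rewrite yE -[LHS]/(_ + _) pcoef_polyC_mul pcoef_polyX_mul IHk exprS.
by rewrite add0r.
Qed.

Lemma pcoef_geometric_corner r s t y k :
  pseries_of_poly (1 - s%:P * 'X) * y = 1 ->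
  pcoef (pseries_of_poly r%:P * y * pseries_of_poly t%:P) k = r * s ^+ k * t.
Proof.
by move=> /pcoef_geometric ys; rewrite pcoef_mul_polyC pcoef_polyC_mul ys.
Qed.

Lemma cohn_geometric_inverse (L : pzRingType)
    (i : {rmorphism {poly R} -> L}) s :
  inverting (@aug_invertible R) i -> exists y : L, i (1 - s%:P * 'X) * y = 1.
Proof.
move=> i_inv.
have /i_inv[Y [/matrixP/(_ 0 0) qY _]] :
    aug_invertible ((1 - s%:P * 'X)%:M : 'M[{poly R}]_1).
  exists 1%:M.
  suff -> : map_mx (@augmentation R) (1 - s%:P * 'X)%:M = 1%:M :> 'M_1.
    by rewrite mulmx1.
  by apply/matrixP=> a b; rewrite !mxE !ord1 /augmentation !hornerE subr0.
by exists (Y 0 0); move: qY; rewrite !mxE big_ord1 !mxE.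
Qed.

(** The power series ring sees [r (1 - s x)^-1 t] only through its Taylor
    coefficients [r s^k t]. *)
Lemma geometric_corner_eq0 (L : pzRingType) (i : {rmorphism {poly R} -> L})
    (gamma : {rmorphism L -> pseries R})
    (gammaE : forall p, gamma (i p) = pseries_of_poly p) r s t (y : L) :
  (forall k, r * s ^+ k * t = 0) -> i (1 - s%:P * 'X) * y = 1 ->
  gamma (i r%:P * y * i t%:P) = 0.
Proof.
move=> rst0 sy; rewrite !rmorphM !gammaE; apply: pseriesP => k.
by rewrite (@pcoef_geometric_corner _ s) ?rst0 // -gammaE -rmorphM sy rmorph1.
Qed.

End GeometricSeries.

(** * Matrix models in which a single relator survives *)

Definition fsg_eval n : free_fsg -> 'M[int]_n.+1 :=
  free_eval (fun i : 'I_3 =>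
    nth 0 [:: delta_mx ord_max ord_max; shift_mx n; delta_mx 0 0] i).

HB.instance Definition _ n := GRing.RMorphism.on (@fsg_eval n).

Lemma fsg_eval_relator n k :
  fsg_eval n free_f * fsg_eval n free_s ^+ k * fsg_eval n free_g
    = (n == k)%:R *: delta_mx ord_max 0.
Proof. by rewrite /fsg_eval !free_evalU corner_shift_pow. Qed.

Lemma fsg_eval_own_relator n :
  fsg_eval n free_f * fsg_eval n free_s ^+ n * fsg_eval n free_g <> 0.
Proof.
rewrite fsg_eval_relator eqxx scale1r => /matrixP/(_ ord_max 0).
by rewrite !mxE !eqxx.
Qed.

(** Membership in the ideal involves finitely many relators, and the relator of
    index [k] is killed by every model with [n > k]. *)
Lemma eventually_fsg_eval0 r :
  in_ideal_span fsg_relator r -> eventually (fun n => fsg_eval n r = 0).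
Proof.
elim=> [_ [k ->]||x y _ evx _ evy|a x _|a x _].
- exists k.+1 => n lt_kn; rewrite !rmorphM rmorphXn /= fsg_eval_relator.
  by rewrite gtn_eqF // scale0r.
- by apply: eventually_all => n; rewrite rmorph0.
- by apply: eventually_impl2 evx evy => n x0 y0; rewrite rmorphB /= x0 y0 subr0.
- by apply: eventually_impl => n x0; rewrite rmorphM /= x0 mulr0.
- by apply: eventually_impl => n x0; rewrite rmorphM /= x0 mul0r.
Qed.

Definition fsg_proj : free_fsg -> ring_fsg := ring_proj fsg_relator.
HB.instance Definition _ := GRing.RMorphism.on fsg_proj.

Lemma fsg_proj_relator k :
  fsg_proj free_f * fsg_proj free_s ^+ k * fsg_proj free_g = 0.
Proof.
rewrite -rmorphXn -!rmorphM -[RHS](rmorph0 fsg_proj); apply/ring_projP.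
by rewrite subr0; apply: in_span_gen; exists k.
Qed.

Lemma fsg_proj_surj r : exists a, fsg_proj a = r.
Proof. by exists (repr r); rewrite /fsg_proj /ring_proj reprK. Qed.

Lemma fsg_proj_eventually a b :
  fsg_proj a = fsg_proj b -> eventually (fun n => fsg_eval n a = fsg_eval n b).
Proof.
move=> /ring_projP/eventually_fsg_eval0; apply: eventually_impl => n.
by rewrite rmorphB => /subr0_eq.
Qed.

Lemma fsg_proj_mx_eventually m k (M N : 'M[free_fsg]_(m, k)) :
  map_mx fsg_proj M = map_mx fsg_proj N ->
  eventually (fun n => map_mx (@fsg_eval n) M = map_mx (@fsg_eval n) N).
Proof.
move=> /matrixP MN; apply: eventually_eq_mx => i j.
have := MN i j; rewrite !mxE => /fsg_proj_eventually.
by apply: eventually_impl => n; rewrite !mxE.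
Qed.

(** * The morphism from [S[x]] to germs of power series over the models *)

Lemma map_poly_surj (A B : nzRingType) (h : {rmorphism A -> B}) :
  (forall b, exists a, h a = b) -> forall q, exists p, map_poly h p = q.
Proof.
move=> /choice[lift liftK] q; exists (\poly_(i < size q) lift q`_i).
apply/polyP=> i; rewrite coef_map coef_poly.
by case: ltnP => [_|le_qi]; [exact: liftK | rewrite raddf0 nth_default].
Qed.

Lemma map_poly_geometric (A B : nzRingType) (h : {rmorphism A -> B}) a :
  map_poly h (1 - a%:P * 'X) = 1 - (h a)%:P * 'X.
Proof. by rewrite rmorphB rmorph1 rmorphM /= map_polyC map_polyX. Qed.

Lemma augmentation_map (A B : nzRingType) (h : {rmorphism A -> B}) p :
  augmentation (map_poly h p) = h (augmentation p).
Proof. by rewrite /augmentation !horner_coef0 coef_map. Qed.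

Definition fsg_poly_eval n : {poly free_fsg} -> pseries 'M[int]_n.+1 :=
  @pseries_of_poly _ \o map_poly (@fsg_eval n).
HB.instance Definition _ n := GRing.RMorphism.on (@fsg_poly_eval n).

Lemma fsg_poly_evalC n a :
  fsg_poly_eval n a%:P = pseries_of_poly (fsg_eval n a)%:P.
Proof. by rewrite /fsg_poly_eval /= map_polyC. Qed.

Lemma fsg_poly_eval_geometric n a :
  fsg_poly_eval n (1 - a%:P * 'X)
    = pseries_of_poly (1 - (fsg_eval n a)%:P * 'X).
Proof. by rewrite /fsg_poly_eval /= map_poly_geometric. Qed.

Definition fsg_seq :
    {poly free_fsg} -> seq_prod (fun n => pseries 'M[int]_n.+1) :=
  seq_map (fun n => fsg_poly_eval n : {rmorphism _ -> _}).
HB.instance Definition _ := GRing.RMorphism.on fsg_seq.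

Definition fsg_germ : {poly free_fsg} -> ring_quot _ := @germ _ \o fsg_seq.
HB.instance Definition _ := GRing.RMorphism.on fsg_germ.

(** The bound from which all coefficients vanish exists because a polynomial has
    finitely many of them. *)
Lemma fsg_germ_ker p : map_poly fsg_proj p = 0 -> fsg_germ p = 0.
Proof.
move=> p0; rewrite -[RHS](rmorph0 (@germ _)); apply/germP.
have: eventually (fun n => forall i : 'I_(size p), fsg_eval n p`_i = 0).
  apply: eventually_forall => i.
  have : fsg_proj p`_i = fsg_proj 0 by rewrite -coef_map p0 coef0 rmorph0.
  move=> /fsg_proj_eventually; apply: eventually_impl => n ->.
  by rewrite rmorph0.
apply: eventually_impl => n pn0; rewrite /fsg_seq /seq_map /fsg_poly_eval /=.
rewrite -[RHS](rmorph0 (@pseries_of_poly _)); congr (pseries_of_poly _).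
apply/polyP=> i; rewrite coef_map coef0 /=.
have [lt_ip|/(nth_default _)->] := ltnP i (size p); last by rewrite rmorph0.
exact: (pn0 (Ordinal lt_ip)).
Qed.

(** An inverse of the augmentation is two matrix equations over [S], which
    survive lifting to the free ring and evaluation in the models of large
    index; in those models the power series ring inverts the matrix. *)
Lemma fsg_germ_inverting
    (hbar : {rmorphism {poly ring_fsg} ->
      ring_quot (@eventually_zero (fun n => pseries 'M[int]_n.+1))}) :
  (forall p, hbar (map_poly fsg_proj p) = fsg_germ p) ->
  inverting (@aug_invertible ring_fsg) hbar.
Proof.
move=> hbarE m k M [N [MN NM]].
have [lift liftK] := choice (map_poly_surj fsg_proj_surj).
have [lift0 lift0K] := choice fsg_proj_surj.
pose M' := map_mx lift M; pose N' := map_mx lift0 N.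
have ME : map_mx (map_poly fsg_proj) M' = M.
  by apply/matrixP=> a b; rewrite !mxE liftK.
have NE : map_mx fsg_proj N' = N by apply/matrixP=> a b; rewrite !mxE lift0K.
have aME : map_mx fsg_proj (map_mx (@augmentation _) M')
    = map_mx (@augmentation _) M.
  by apply/matrixP=> a b; rewrite -ME !mxE augmentation_map.
have -> : map_mx hbar M = map_mx (@germ _) (map_mx fsg_seq M').
  by apply/matrixP=> a b; rewrite -ME !mxE hbarE.
apply: germ_mx_invertible.
suff: eventually (fun n => aug_invertible (map_mx (map_poly (@fsg_eval n)) M')).
  apply: eventually_impl => n /pseries_of_poly_inverting.
  by congr (mx_invertible _); apply/matrixP=> a b; rewrite !mxE.
rewrite -aME -NE -!map_mxM -!(map_mx1 fsg_proj) in MN NM.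
apply: eventually_impl2 (fsg_proj_mx_eventually MN) (fsg_proj_mx_eventually NM).
move=> n; rewrite !map_mxM !map_mx1 => MNn NMn.
exists (map_mx (@fsg_eval n) N').
suff -> : map_mx (@augmentation _) (map_mx (map_poly (@fsg_eval n)) M') =
    map_mx (@fsg_eval n) (map_mx (@augmentation _) M') by [].
by apply/matrixP=> a b; rewrite !mxE augmentation_map.
Qed.

(** Two equations between germs hold together at some index [N], where the
    hypothesis for [n = N] contradicts the vanishing of the coefficient of
    [x^N]. *)
Lemma fsg_germ_corner_neq0 (r s t : free_fsg) b :
  (forall n, fsg_eval n r * fsg_eval n s ^+ n * fsg_eval n t <> 0) ->
  fsg_germ (1 - s%:P * 'X) * b = 1 -> fsg_germ r%:P * b * fsg_germ t%:P <> 0.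
Proof.
move=> rst_neq0; have [v <-] := germ_surj b; rewrite /fsg_germ => sv1 rvt0.
have ev1 : eventually (fun n => fsg_poly_eval n (1 - s%:P * 'X) * v n = 1).
  by apply/(@germP _ (fsg_seq _ * v) 1); rewrite rmorphM rmorph1.
have ev0 : eventually (fun n =>
    fsg_poly_eval n r%:P * v n * fsg_poly_eval n t%:P = 0).
  by apply/(@germP _ (fsg_seq _ * v * fsg_seq _) 0); rewrite 2!rmorphM rmorph0.
have [N /(_ N (leqnn N))[]] := eventually_impl2 (fun n => @conj _ _) ev1 ev0.
rewrite fsg_poly_eval_geometric 2!fsg_poly_evalC.
move=> /pcoef_geometric_corner vN /(congr1 (fun a => pcoef a N)).
by rewrite vN => /rst_neq0.
Qed.

Theorem proposition1p2
    (L : pzRingType) (i : {rmorphism {poly ring_fsg} -> L})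
    (i_univ : is_cohn_localization (@aug_invertible ring_fsg) i)
    (gamma : {rmorphism L -> pseries ring_fsg})
    (gammaE : forall p : {poly ring_fsg}, gamma (i p) = pseries_of_poly p) :
  ~ injective gamma.
Proof.
have [i_inv i_lift] := i_univ.
have [hbar hbarE] :=
  rmorphism_factor (map_poly_surj fsg_proj_surj) fsg_germ_ker.
have [theta [thetaE _]] := i_lift _ hbar (fsg_germ_inverting hbarE).
have [y sy] := cohn_geometric_inverse (fsg_proj free_s) i_inv.
have gamma_z := geometric_corner_eq0 gammaE fsg_proj_relator sy.
move=> gamma_inj.
have fyg0 : i (fsg_proj free_f)%:P * y * i (fsg_proj free_g)%:P = 0.
  by apply: gamma_inj; rewrite gamma_z rmorph0.
have theta_germ p q : map_poly fsg_proj p = q -> theta (i q) = fsg_germ p.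
  by move=> <-; rewrite thetaE hbarE.
have theta_corner r t :
    i (fsg_proj r)%:P * y * i (fsg_proj t)%:P = 0 ->
    fsg_germ r%:P * theta y * fsg_germ t%:P = 0.
  have germC a := theta_germ _ _ (map_polyC fsg_proj a).
  by move=> z0; rewrite -!germC -!(rmorphM theta) z0 (rmorph0 theta).
have germ_s := theta_germ _ _ (map_poly_geometric fsg_proj free_s).
apply: (fsg_germ_corner_neq0 (b := theta y) fsg_eval_own_relator).
  by rewrite -germ_s -rmorphM sy rmorph1.
exact: theta_corner fyg0.
Qed.
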